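(* Let $A$ be an integral domain and $E$ a finitely generated comultiplication $A$-module such that $\operatorname{ann}(E)$ is a semiprime ideal of $A$. Then $qD_A(E)$ is a $T_1$-space if and only if $qD_A(E)$ is empty or a discrete space with $|\operatorname{EC}(W(E)^{\#})|=2$.
   Context: For an $A$-module $E$: $\operatorname{ann}(E)=\{a\in A: aE=0\}$, $W(E)=\{a\in A: aE\neq E\}$, $W(E)^{\#}=W(E)\setminus\operatorname{ann}(E)$. On $W(E)^{\#}$ put $a\sim b$ iff $aE=bE$; $[a]$ is the class of $a$ and $\operatorname{EC}(W(E)^{\#})$ is the set of all classes. For $a\in W(E)^{\#}$, $U_a=\{[b]\in\operatorname{EC}(W(E)^{\#}): aE\subseteq bE\}$. The quasi divisor topology $qD_A(E)$ is the topological space $\operatorname{EC}(W(E)^{\#})$ whose topology has basis $\{U_a\}_{a\in W(E)^{\#}}$. $E$ is a comultiplication module if for every submodule $N$ of $E$ there is an ideal $I$ of $A$ with $N=\operatorname{ann}_E(I)=\{m\in E: Im=0\}$. A proper ideal $I$ of $A$ is semiprime if $a^n\in I$ ($a\in A$, $n\ge 1$) implies $a\in I$. *)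

(* Defs.v *)
From HB Require Import structures.
From mathcomp Require Import all_boot all_order all_algebra generic_quotient.
From mathcomp Require Import boolp classical_sets functions cardinality topology.

Set Implicit Arguments.
Unset Strict Implicit.
Unset Printing Implicit Defensive.

Import GRing.Theory.

Local Open Scope classical_set_scope.
Local Open Scope ring_scope.
Local Open Scope quotient_scope.

Section ModuleNotions.
Variables (A : comNzRingType) (E : lmodType A).

Definition smul_image (a : A) : set E := [set a *: x | x in [set: E]].

Definition module_ann : set A := [set a | smul_image a = [set 0]].

Definition W : set A := [set a | smul_image a <> [set: E]].

Definition Wsharp : set A := W `\` module_ann.

Definition is_submodule (N : set E) : Prop := GRing.submod_closed [in N].

Definition ann_in_module (I : set A) : set E :=
  [set m | forall a, I a -> a *: m = 0].

Definition finitely_generated : Prop :=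
  exists (n : nat) (g : 'I_n -> E),
    forall x : E, exists c : 'I_n -> A, x = \sum_(i < n) c i *: g i.

End ModuleNotions.

Arguments smul_image {A} E a.
Arguments module_ann {A} E.
Arguments W {A} E.
Arguments Wsharp {A} E.
Arguments ann_in_module {A} E I.
Arguments finitely_generated {A} E.

(* Ideals may be improper, which [idealr_closed] of ring_quotient excludes;
   they are the submodules of the regular module. *)
Definition is_ideal (A : comNzRingType) (I : set A) : Prop :=
  is_submodule (E := A^o) I.

Definition semiprime_ideal (A : comNzRingType) (I : set A) : Prop :=
  [/\ is_ideal I, I <> [set: A] &
      forall (a : A) (n : nat), (1 <= n)%N -> I (a ^+ n) -> I a].

Definition comultiplication_module (A : comNzRingType) (E : lmodType A) : Prop :=
  forall N : set E, is_submodule N ->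
    exists2 I : set A, is_ideal I & N = ann_in_module E I.

Definition discrete_space (X : topologicalType) : Prop :=
  forall S : set X, open S.

Section QuasiDivisorTopology.
Variables (A : comNzRingType) (E : lmodType A).

Definition same_image (a b : Wsharp E) : bool :=
  `[< smul_image E (val a) = smul_image E (val b) >].

Lemma same_image_refl : reflexive same_image.
Proof. by move=> a; apply/asboolP. Qed.

Lemma same_image_sym : symmetric same_image.
Proof. by move=> a b; apply/asboolP/asboolP. Qed.

Lemma same_image_trans : transitive same_image.
Proof. by move=> b a c /asboolP ab /asboolP bc; apply/asboolP; rewrite ab. Qed.

Canonical same_image_equiv :=
  EquivRel same_image same_image_refl same_image_sym same_image_trans.

Definition EC : Type := {eq_quot same_image}.

HB.instance Definition _ := Choice.on EC.
HB.instance Definition _ := EqQuotient.on EC.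

Definition ec_class (a : Wsharp E) : EC := \pi_EC a.

Definition qD_basic (a : Wsharp E) : set EC :=
  [set ec_class b | b in
     [set b : Wsharp E | smul_image E (val a) `<=` smul_image E (val b)]].

Definition qD : Type := EC.

HB.instance Definition _ := Choice.on qD.

Lemma qD_basic_class (a b : Wsharp E) :
  qD_basic a (ec_class b) <-> smul_image E (val a) `<=` smul_image E (val b).
Proof.
split=> [[c ac /eqmodP/asboolP <-//]|ab]; by exists b.
Qed.

Let qD_cover : \bigcup_(U in range qD_basic) U = [set: qD].
Proof.
rewrite -subTset => x _; exists (qD_basic (repr x)); first by exists (repr x).
by rewrite -[X in qD_basic _ X]reprK; apply/qD_basic_class.
Qed.

Let qD_join (U V : set qD) (x : qD) :
  range qD_basic U -> range qD_basic V -> U x -> V x ->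
  exists X : set qD, [/\ range qD_basic X, X x & X `<=` U `&` V].
Proof.
move=> [a _ <-] [b _ <-]; rewrite -[x]reprK.
move=> /qD_basic_class ax /qD_basic_class bx.
exists (qD_basic (repr x)); split; first by exists (repr x).
  by apply/qD_basic_class.
by move=> _ [c xc <-]; split; apply/qD_basic_class; apply: subset_trans xc.
Qed.

(* The open sets are the unions of sets [qD_basic a]. *)
HB.instance Definition _ :=
  @isBaseTopological.Build qD (set qD) (range qD_basic) id qD_cover qD_join.

End QuasiDivisorTopology.

Arguments EC {A} E.
Arguments qD {A} E.

(* Main.v *)
Require Import Defs.
From mathcomp Require Import all_boot all_order all_algebra.
From mathcomp Require Import boolp classical_sets functions cardinality topology.
From mathcomp Require Import ring.

Set Implicit Arguments.
Unset Strict Implicit.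
Unset Printing Implicit Defensive.

Import GRing.Theory.

Local Open Scope classical_set_scope.

(** Points of [qD E] specialize along inclusion of images: every open set
    containing [[a]] contains [[b]] whenever [aE] is included in [bE].  So [qD E]
    is a T1 space exactly when no image [aE] with [a] in [Wsharp E] is properly
    included in another one, and it is then discrete.

    Suppose this holds and let [a] be in [Wsharp E].  Semiprimeness of [ann(E)]
    gives [a ^+ 2] outside [ann(E)], so [a ^+ 2] is in [Wsharp E] and
    [a^2 E = aE].  Since [E] is finitely generated, the determinant trick yields
    [t] such that [a * t] acts as the identity on [aE] ([square_image_split]).
    Then [d = 1 - a * t] satisfies [d a E = 0], and [E] is the direct sum of [aE]
    and [dE]: the element [d] is again in [Wsharp E], and its class differs from
    that of [a] ([Wsharp_complement], [complement_image_neq]).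

    There is no third class.  As [1 = a * t + d], an element [b] of [Wsharp E]
    cannot have both [a * b] and [d * b] in [ann(E)]; and if [c * b] is outside
    [ann(E)] for some [c] in [Wsharp E], the image [cbE] lies in both [cE] and
    [bE], which are therefore equal ([eq_image_of_mul]).  So [bE] is [aE] or
    [dE]. *)

(** * The determinant trick *)

Section DeterminantTrick.
Local Open Scope ring_scope.
Variable A : comNzRingType.

(** The determinant is polynomial in the entries, so it is compatible with
    congruence modulo the ideal generated by [a]. *)
Lemma det_congr (a : A) (n : nat) (M N : 'M[A]_n) :
  (forall i j, exists t, M i j = N i j + a * t) ->
  exists t, \det M = \det N + a * t.
Proof.
move=> MN; pose R (x y : A) := exists t, x = y + a * t.
have Rxx x : R x x by exists 0; rewrite mulr0 addr0.
have RD x1 x2 y1 y2 : R x1 x2 -> R y1 y2 -> R (x1 + y1) (x2 + y2).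
  by move=> [s ->] [t ->]; exists (s + t); rewrite mulrDr addrACA.
have RM x1 x2 y1 y2 : R x1 x2 -> R y1 y2 -> R (x1 * y1) (x2 * y2).
  move=> [s ->] [t ->]; exists (x2 * t + s * (y2 + a * t)).
  ring.
rewrite -/(R _ _) /determinant; apply: (big_ind2 R) => // s _.
by apply: (RM) => //; apply: (big_ind2 R) => // i _; exact: MN.
Qed.

Variable E : lmodType A.

(** Over a commutative ring the adjugate turns a homogeneous linear system into
    the annihilation of each unknown by the determinant. *)
Lemma det_annihilates (n : nat) (M : 'M[A]_n) (h : 'I_n -> E) :
  (forall i, \sum_j M i j *: h j = 0) -> forall i, \det M *: h i = 0.
Proof.
move=> Mh i.
have -> : \det M *: h i = \sum_k ((\adj M *m M) i k) *: h k.
  rewrite mul_adj_mx (bigD1 i) //= big1 => [|k ki].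
    by rewrite !mxE eqxx mulr1n addr0.
  by rewrite !mxE eq_sym (negPf ki) mulr0n scale0r.
transitivity (\sum_k \sum_j (\adj M i j * M j k) *: h k).
  by apply: eq_bigr => k _; rewrite mxE scaler_suml.
rewrite exchange_big big1 //= => j _.
under eq_bigr => k _ do rewrite -scalerA.
by rewrite -scaler_sumr Mh scaler0.
Qed.

(** Nakayama's lemma for the submodule [aE], which is finitely generated and
    satisfies [a(aE) = aE]: the generators [a *: g i] of [aE] solve a linear
    system whose matrix [M] is congruent to the identity modulo [a], so its
    determinant [1 - a * t] kills [aE].  In other words [a * t] is idempotent
    modulo [ann(E)]. *)
Lemma square_image_split (a : A) :
  finitely_generated E -> smul_image E a `<=` smul_image E (a ^+ 2) ->
  exists t, forall x : E, (1 - a * t) *: (a *: x) = 0.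
Proof.
move=> [n [g gE]] aa.
have /choice[c cE] i : exists c : 'I_n -> A,
    a *: g i = \sum_j (a * c j) *: (a *: g j).
  have [|y _ <-] := aa (a *: g i); first by exists (g i).
  have [c ->] := gE y; exists c; rewrite scaler_sumr.
  by apply: eq_bigr => j _; rewrite !scalerA expr2 mulrAC.
pose M : 'M[A]_n := \matrix_(i, j) ((i == j)%:R - a * c i j).
have Mg i : \sum_j M i j *: (a *: g j) = 0.
  transitivity (\sum_j ((i == j)%:R *: (a *: g j)
                        - (a * c i j) *: (a *: g j))).
    by apply: eq_bigr => j _; rewrite mxE scalerBl.
  rewrite sumrB -cE (bigD1 i) //= big1 => [|j ji].
    by rewrite eqxx scale1r addr0 subrr.
  by rewrite eq_sym (negPf ji) scale0r.
have [|t detM] := @det_congr a n M 1%:M.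
  by move=> i j; exists (- c i j); rewrite !mxE mulrN.
exists (- t) => x; have [b ->] := gE x.
rewrite !scaler_sumr big1 // => i _.
rewrite mulrN opprK -[1](det1 A n) -detM.
have swap (u v : A) (y : E) : u *: (v *: y) = v *: (u *: y).
  by rewrite !scalerA mulrC.
by have /= detg := det_annihilates Mg i; rewrite (swap a) (swap (\det M)) detg scaler0.
Qed.

End DeterminantTrick.

(** * Images of multiplications *)

Section Images.
Local Open Scope ring_scope.
Variables (A : comNzRingType) (E : lmodType A).
Implicit Types a b c d t : A.

Lemma module_annP a : module_ann E a <-> forall x : E, a *: x = 0.
Proof.
split=> [aE x|a0].
  have : smul_image E a (a *: x) by exists x.
  by rewrite aE.
by apply/seteqP; split=> [_ [x _ <-]|_ ->]; [exact: a0|exists 0; rewrite ?scaler0].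
Qed.

Lemma smul_imageMl a b : smul_image E (a * b) `<=` smul_image E a.
Proof. by move=> _ [x _ <-]; exists (b *: x); rewrite ?scalerA. Qed.

Lemma smul_imageMr a b : smul_image E (a * b) `<=` smul_image E b.
Proof. by rewrite mulrC; exact: smul_imageMl. Qed.

Lemma WsharpM a b : Wsharp E a -> ~ module_ann E (a * b) -> Wsharp E (a * b).
Proof.
move=> [aW _] ab; split=> // abE; apply: aW; rewrite -subTset -abE.
exact: smul_imageMl.
Qed.

Definition images_antichain :=
  forall a b, Wsharp E a -> Wsharp E b ->
  smul_image E a `<=` smul_image E b -> smul_image E a = smul_image E b.

(** The image [abE] lies in both [aE] and [bE], and none of the three can be
    smaller than another. *)
Lemma eq_image_of_mul a b : images_antichain -> Wsharp E a -> Wsharp E b ->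
  ~ module_ann E (a * b) -> smul_image E a = smul_image E b.
Proof.
move=> anti aW bW ab; have abW := WsharpM aW ab.
transitivity (smul_image E (a * b)).
  by apply/esym/(anti _ _ abW aW); exact: smul_imageMl.
by apply: (anti _ _ abW bW); exact: smul_imageMr.
Qed.

Section Complement.
Variables (a t : A).
Hypothesis da0 : forall x : E, (1 - a * t) *: (a *: x) = 0.

(** If [dE = E] with [d = 1 - a * t], then [a] kills [dE = E]; if [dE = 0], then
    [a * t] is the identity of [E] and [aE = E]. *)
Lemma Wsharp_complement : Wsharp E a -> Wsharp E (1 - a * t).
Proof.
move=> [aW aann]; split=> [dE|/module_annP d0].
  apply/aann/module_annP => x.
  have : smul_image E (1 - a * t) x by rewrite dE.
  by move=> [y _ <-]; rewrite scalerA mulrC -scalerA da0.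
apply: aW; rewrite -subTset => x _; exists (t *: x) => //.
by apply/esym/subr0_eq; rewrite -[X in X - _]scale1r scalerA -scalerBl d0.
Qed.

(** [a] kills [dE], whereas [a] kills [aE] only if [a ^+ 2] is in [ann(E)]. *)
Lemma complement_image_neq : semiprime_ideal (module_ann E) -> Wsharp E a ->
  smul_image E a <> smul_image E (1 - a * t).
Proof.
move=> [_ _ semi] [_ aann] aEdE; apply/aann/(semi a 2) => //.
apply/module_annP => x.
have : smul_image E (1 - a * t) (a *: x) by rewrite -aEdE; exists x.
move=> [y _ dy]; rewrite expr2 -scalerA -dy scalerA mulrC -scalerA.
exact: da0.
Qed.

(** At least one of [a * b] and [d * b] is outside [ann(E)], because [a] and
    [d = 1 - a * t] generate the unit ideal and [b] is not in [ann(E)]. *)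
Lemma image_dichotomy b : images_antichain -> Wsharp E a -> Wsharp E b ->
  smul_image E a = smul_image E b \/
  smul_image E (1 - a * t) = smul_image E b.
Proof.
move=> anti aW bW; have dW := Wsharp_complement aW.
have [/module_annP ab|] := pselect (module_ann E (a * b)); last first.
  by left; exact: eq_image_of_mul.
right; apply: eq_image_of_mul => // /module_annP db; case: bW => _; apply.
apply/module_annP => x.
(* b = t * (a * b) + d * b with d = 1 - a * t *)
rewrite -[b]mul1r -[1](subrK (a * t)) mulrDl scalerDl db add0r.
by rewrite mulrAC mulrC -scalerA ab scaler0.
Qed.

End Complement.

Lemma Wsharp_sqr a :
  semiprime_ideal (module_ann E) -> Wsharp E a -> Wsharp E (a ^+ 2).
Proof.
move=> [_ _ semi] aW; rewrite expr2; apply: (WsharpM aW).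
by move=> a2; apply: aW.2; exact: (semi a 2).
Qed.

End Images.

(** * The quasi divisor topology *)

Section Topology.
Variables (A : comNzRingType) (E : lmodType A).
Implicit Types a b : Wsharp E.

(** [ec_class] viewed in the copy of the quotient that carries the topology. *)
Definition qD_class a : qD E := ec_class a.

Lemma qD_classP (x : qD E) : exists a, x = qD_class a.
Proof. by exists (repr (x : EC E)); rewrite /qD_class /ec_class reprK. Qed.

Lemma eq_qD_class a b :
  qD_class a = qD_class b <-> smul_image E (val a) = smul_image E (val b).
Proof.
split=> [/eqmodP/asboolP //|ab]; exact/eqmodP/asboolP.
Qed.

(** [qD_class b] lies in every basic open set containing [qD_class a] as soon as
    [aE] is included in [bE], by transitivity of inclusion. *)
Lemma open_qD_class (U : set (qD E)) a b : open U ->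
  smul_image E (val a) `<=` smul_image E (val b) ->
  U (qD_class a) -> U (qD_class b).
Proof.
move=> [D Dbasic <-] ab [V DV Va]; exists V => //.
have [c _ cV] := Dbasic _ DV; move: Va; rewrite /= -cV => /qD_basic_class ca.
by apply/qD_basic_class; exact: subset_trans ab.
Qed.

Lemma open_qD_basic a : open (qD_basic a : set (qD E)).
Proof.
exists [set (qD_basic a : set (qD E))]; first by move=> _ ->; exists a.
by rewrite bigcup_set1.
Qed.

Lemma accessible_images_antichain :
  accessible_space (qD E) -> images_antichain E.
Proof.
move=> T1 a b aW bW ab; pose a' : Wsharp E := SigSub (mem_set aW).
pose b' : Wsharp E := SigSub (mem_set bW).
apply/(eq_qD_class a' b'); apply/eqP/negP => /negP /T1[U [oU]].
rewrite !inE => Ua; apply; exact: open_qD_class Ua.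
Qed.

(** Each basic open set [qD_basic a] is the singleton of the class of [a]. *)
Lemma images_antichain_discrete :
  images_antichain E -> discrete_space (qD E).
Proof.
move=> anti S.
have -> : S = \bigcup_(a in [set a | S (qD_class a)]) qD_basic a.
  apply/seteqP; split=> x.
    by have [a ->] := qD_classP x => Sa; exists a => //; exact/qD_basic_class.
  move=> [a /= Sa]; have [b ->] := qD_classP x => /qD_basic_class ab.
  suff <- : qD_class a = qD_class b by [].
  by apply/eq_qD_class/anti => //; exact/set_mem/valP.
by apply: bigcup_open => a _; exact: open_qD_basic.
Qed.

Lemma discrete_accessible (X : topologicalType) :
  discrete_space X -> accessible_space X.
Proof.
move=> dX x y xy; exists [set x]; split; rewrite ?inE //=.
by move=> yx; rewrite yx eqxx in xy.
Qed.

End Topology.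

Lemma card_set2 (T : Type) (x y : T) : x <> y -> ([set x; y] #= `I_2)%card.
Proof.
move=> xy; apply/eq_cardSP; exists x; first by left.
suff -> : [set x; y] `\ x = [set y] by exact: card_set1.
apply/seteqP; split=> [z [[]//]|_ ->].
by split; [right|move=> /esym].
Qed.

Theorem theorem14 (A : idomainType) (E : lmodType A)
  (Efg : finitely_generated E)
  (Ecomult : comultiplication_module E)
  (annE_semiprime : semiprime_ideal (module_ann E)) :
  accessible_space (qD E) <->
  ([set: qD E] = set0 \/
   (discrete_space (qD E) /\ ([set: EC E] #= `I_2)%card)).
Proof.
split=> [T1|[qD0|[dE _]]]; last exact: discrete_accessible.
- have anti := accessible_images_antichain T1.
  have [|/set0P[x _]] := eqVneq [set: qD E] set0; first by left.
  right; split; first exact: images_antichain_discrete.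
  have [a _] := qD_classP x; have aW : Wsharp E (val a) by exact/set_mem/valP.
  have a2E := anti _ _ (Wsharp_sqr annE_semiprime aW) aW (@smul_imageMl _ _ _ _).
  have [|t da0] := @square_image_split _ E (val a) Efg; first by rewrite a2E.
  pose d : Wsharp E := SigSub (mem_set (Wsharp_complement da0 aW)).
  suff -> : [set: EC E] = [set qD_class a; qD_class d].
    apply: card_set2 => /eq_qD_class.
    exact: complement_image_neq da0 annE_semiprime aW.
  apply/seteqP; split=> // y _; have [b ->] := qD_classP y.
  have bW : Wsharp E (val b) by exact/set_mem/valP.
  by case: (image_dichotomy da0 anti aW bW) => ab; [left|right];
    apply/eq_qD_class.
- by move=> x; have : [set: qD E] x by []; rewrite qD0.
Qed.
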